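(* Let $F:\mathbb R^{n-1}\to\mathbb R$ be $C^\infty$ and convex, $\mathcal O=\{x\in\mathbb R^n:x_1<-F(x')\}$, and let $P$ be the wave operator $\Box=-\partial_t^2+\Delta$ in $\mathbb R^n\setminus\overline{\mathcal O}$ written in the coordinates $(t,y)$ of the context, so that the boundary is $\{y_1=0\}$. Let $\phi_{\rm i}$ be an incoming phase and let $\phi_{\rm r}$ be the associated reflected phase on $\mathring J_{\rm r}$, as in the context. Then $$\partial_{y_1}\phi_{\rm r}>0\quad\text{at all points of }\mathring J_{\rm r};$$ in particular $\partial_{y_1}\phi_{\rm r}\ne0$ on $\mathring J_{\rm r}$, for grazing of any order.
   Context: Coordinates (used locally near $0\in\partial\mathcal O$): $y_1=x_1+F(x')$, $y'=G(x)$, where $G=(G_2,\dots,G_n)$ is smooth with values in $\mathbb R^{n-1}$ and solves $\partial_{x_1}G_j+\nabla_{x'}F\cdot\nabla_{x'}G_j=0$, $G(-F(x'),x')=x'$. In these coordinates the symbol of $\Box$ is $\sigma(\Box)=(1+|\nabla_{x'}F|^2)\,p(t,y,\tau,\eta)$ with $p=\eta_1^2+q(y,\tau,\eta')$, $q=\dfrac{|\langle\partial_{x_1}G,\eta'\rangle|^2+|(\nabla_{x'}G)^{\top}\eta'|^2-\tau^2}{1+|\nabla_{x'}F|^2}$, where $\nabla_{x'}G$ is the matrix $(\partial_{x_k}G_j)_{j,k}$. Incoming phase: a $C^\infty$ function $\phi_{\rm i}(t,y)$ on an open ball $U$ about $0$ in $\mathbb R^{n+1}$ with $p(t,y,\partial_t\phi_{\rm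 i},\nabla_y\phi_{\rm i})=0$, $\partial_t\phi_{\rm i}<0$, $\phi_{\rm i}(0)=0$, $\partial_{y_1}\phi_{\rm i}(0)=0$, and such that the bicharacteristic (integral curve of the Hamiltonian field $H_p$) through $(0,\partial_t\phi_{\rm i}(0),\nabla_y\phi_{\rm i}(0))$ lies over $\{y_1>0\}$ for small nonzero parameter (grazing of finite or infinite order). $G_{\phi_{\rm i}}=\{(t,0,y')\in U:\partial_{y_1}\phi_{\rm i}=0\}$. Flowouts, for $T>0$ small: $T_{\phi_{\rm i}}=\partial_{\tau,\eta}p(t,y,\partial_t\phi_{\rm i},\nabla\phi_{\rm i})\cdot\partial_{t,y}$. $\mathcal U$ is a small closed $n$-dimensional ball in $\{t=-T,\ y_1>0\}$; $J_{\rm i}$ is the set of points reached from $\mathcal U$ along forward integral curves of $T_{\phi_{\rm i}}$ until they leave $\{y_1\ge0\}$ or reach $t=T$; $V=J_{\rm i}\cap\{y_1=0\}$, $V_{\rm r}=\{(t,y'):(t,0,y')\in V\}$, $\mathring V_{\rm r}=\{(t,y'):(t,0,y')\in V\setminus G_{\phi_{\rm i}}\}$. For $(t_0,y_0')\in V_{\rm r}$ let $(t,y,\tau,\eta)(s,t_0,y_0')$ be the bicharacteristic of $p$ starting at $s=0$ from $(t,y,\tau,\eta_1,\eta')=(t_0,0,y_0',\partial_t\phi_{\rm i},-\partial_{y_1}\phi_{\rm i},\nabla_{y'}\phi_{\rm i})$ (derivatives at $(t_0,0,y_0')$), and $Z_{\rm r}(s,t_0,y_0')=(t,y)(s,t_0,y_0')$,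 followed for $0\le s<s_0$ and $t\le T$. It is assumed that $\mathcal U$ and $s_0>0$ are chosen so that $Z_{\rm r}$ on $[0,s_0)\times V_{\rm r}$ (with $t\le T$) is a homeomorphism onto its range $J_{\rm r}$ and on $[0,s_0)\times\mathring V_{\rm r}$ is a $C^\infty$ diffeomorphism onto its range $\mathring J_{\rm r}$. The reflected phase is defined by $\phi_{\rm r}(Z_{\rm r}(s,t_0,y_0'))=\phi_{\rm i}(t_0,0,y_0')$ and satisfies $(\partial_t\phi_{\rm r},\nabla_y\phi_{\rm r})(Z_{\rm r}(s,t_0,y_0'))=(\tau,\eta)(s,t_0,y_0')$; it solves the eikonal equation on $\mathring J_{\rm r}$ with $\phi_{\rm r}=\phi_{\rm i}$, $\partial_{y_1}\phi_{\rm r}=-\partial_{y_1}\phi_{\rm i}$ on $V$. *)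

(* Defs.v *)
From HB Require Import structures.
From mathcomp Require Import all_boot all_order all_algebra.
From mathcomp Require Import all_classical all_reals all_analysis.
From mathcomp Require Import ring.
Set Implicit Arguments.
Unset Strict Implicit.
Unset Printing Implicit Defensive.
Import Order.TTheory GRing.Theory Num.Theory.
Import numFieldNormedType.Exports.
Local Open Scope classical_set_scope.
Local Open Scope ring_scope.

(* For n >= 2:
     tan_space R n = R^(n-1)   the variables x', y' and eta'
     x_space R n   = R^n       pairs (x_1, x') or (y_1, y')
     tx_space R n  = R^(n+1)   pairs (t, (y_1, y'))
   Covectors (tau, (eta_1, eta')) also have type tx_space R n. *)
Notation tan_space R n := 'rV[R]_(n.-1).
Notation x_space R n := (R * tan_space R n)%type.
Notation tx_space R n := (R * x_space R n)%type.

Section smoothness.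
Context {R : realType} {V W : normedModType R}.
Implicit Types (f : V -> W) (A D : set V).

Fixpoint iterD (vs : seq V) f : V -> W :=
  if vs is v :: vs' then fun x => 'D_v (iterD vs' f) x else f.

(* C^infty on an open set D of a finite-dimensional space V: directional
   derivatives of all orders exist and are continuous on D. *)
Definition smooth_on D f := forall vs : seq V, forall x, D x ->
  {for x, continuous (iterD vs f)} /\
  forall v, derivable (iterD vs f) x v.

(* C^infty on a set A that need not be open: f agrees on A with a C^infty
   function defined on an open neighbourhood of A. *)
Definition smooth_within A f := exists D g,
  [/\ open D, A `<=` D, smooth_on D g & forall x, A x -> f x = g x].

Definition homeomorphism_on A f := {within A, continuous f} /\
  exists g : W -> V,
    {within f @` A, continuous g} /\ forall x, A x -> g (f x) = x.

End smoothness.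

Definition diffeomorphism_on {R : realType} {V W : normedModType R}
    (A : set V) (f : V -> W) := smooth_within A f /\
  exists g : W -> V,
    smooth_within (f @` A) g /\ forall x, A x -> g (f x) = x.

Section gradients.
Context {R : realType} {n : nat}.

(* Euclidean inner product; the library norm on rows and pairs is the sup norm *)
Definition dotr {m : nat} (u v : 'rV[R]_m) : R := \sum_j u 0 j * v 0 j.

Definition sqnormx (y : x_space R n) : R := y.1 ^+ 2 + dotr y.2 y.2.
Definition sqnormtx (z : tx_space R n) : R := z.1 ^+ 2 + sqnormx z.2.

Definition gradT (f : tan_space R n -> R) (x' : tan_space R n) :
    tan_space R n :=
  \row_j 'D_(delta_mx 0 j) f x'.

Definition gradx (f : x_space R n -> R) (x : x_space R n) : x_space R n :=
  ('D_(1, 0) f x, \row_j 'D_(0, delta_mx 0 j) f x).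

Definition gradtx (f : tx_space R n -> R) (z : tx_space R n) :
    tx_space R n :=
  ('D_(1, 0) f z,
   ('D_(0, (1, 0)) f z, \row_j 'D_(0, (0, delta_mx 0 j)) f z)).

End gradients.

Section chart.
Context {R : realType} {n : nat}.
Variables (F : tan_space R n -> R) (G : x_space R n -> tan_space R n).

Definition obstacle : set (x_space R n) := [set x | x.1 < - F x.2].

(* x |-> (y_1, y') *)
Definition chart (x : x_space R n) : x_space R n := (x.1 + F x.2, G x).

Definition Gcomp (j : 'I_n.-1) (x : x_space R n) : R := G x 0 j.

Definition dG1 (x : x_space R n) : tan_space R n :=
  \row_j (gradx (Gcomp j) x).1.

(* the matrix (d_{x_k} G_j)_{j,k} *)
Definition dGT (x : x_space R n) : 'M[R]_(n.-1) :=
  \matrix_(j, k) (gradx (Gcomp j) x).2 0 k.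

(* G and the inverse chart chi are only given locally: G on the open
   neighbourhood W of 0, chi on the open set chart @` W. *)
Record boundary_chart (W : set (x_space R n)) (chi : x_space R n -> x_space R n) :
    Prop := BoundaryChart {
  chart_open : open W;
  chart_at0 : W 0;
  chart_smooth : smooth_on W G;
  chart_transport : forall x, W x -> forall j,
    (gradx (Gcomp j) x).1 + dotr (gradT F x.2) (gradx (Gcomp j) x).2 = 0;
  chart_boundary : forall x', W (- F x', x') -> G (- F x', x') = x';
  chart_image_open : open (chart @` W);
  chart_inv_smooth : smooth_on (chart @` W) chi;
  chart_invK : forall x, W x -> chi (chart x) = x
}.

Definition symbol_q (chi : x_space R n -> x_space R n) (y : x_space R n)
    (tau : R) (eta' : tan_space R n) : R :=
  let x := chi y in
  let v := eta' *m dGT x in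
  (dotr (dG1 x) eta' ^+ 2 + dotr v v - tau ^+ 2)
    / (1 + dotr (gradT F x.2) (gradT F x.2)).

Definition symbol_p (chi : x_space R n -> x_space R n) (z zeta : tx_space R n) : R :=
  zeta.2.1 ^+ 2 + symbol_q chi z.2 zeta.1 zeta.2.2.

(* Covector in the variables x corresponding to eta in the variables y. *)
Definition pullback_covector (x eta : x_space R n) : x_space R n :=
  (eta.1 + dotr (dG1 x) eta.2, eta.1 *: gradT F x.2 + eta.2 *m dGT x).

(* (1 + |grad F|^2) p is the principal symbol |xi|^2 - tau^2 of the wave
   operator - d_t^2 + Laplacian (up to its overall sign), read in the
   coordinates (t, y). *)
Lemma symbol_pE (W : set (x_space R n)) (chi : x_space R n -> x_space R n)
    (t : R) (x : x_space R n) (zeta : tx_space R n) :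
  boundary_chart W chi -> W x ->
  (1 + dotr (gradT F x.2) (gradT F x.2)) * symbol_p chi (t, chart x) zeta
  = sqnormx (pullback_covector x zeta.2) - zeta.1 ^+ 2.
Proof.
move=> hW Wx; rewrite /symbol_p /symbol_q /= (chart_invK hW Wx).
set a := dotr (gradT F x.2) (gradT F x.2); set v := _ *m _.
have a1 : 1 + a != 0.
  rewrite gt_eqF// ltr_pwDl// /a /dotr sumr_ge0// => j _.
  by rewrite -expr2 sqr_ge0.
rewrite mulrDr [X in _ + X]mulrC divfK// /sqnormx /pullback_covector /= -/v.
have orth : dotr (gradT F x.2) v = - dotr (dG1 x) zeta.2.2.
  have -> : dotr (gradT F x.2) v =
     \sum_j zeta.2.2 0 j * dotr (gradT F x.2) (gradx (Gcomp j) x).2.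
    under eq_bigr do rewrite mulr_sumr.
    rewrite exchange_big/=; apply: eq_bigr => k _.
    rewrite !mxE mulr_sumr; apply: eq_bigr => j _.
    by rewrite !mxE; ring.
  rewrite /dotr -sumrN; apply: eq_bigr => j _.
  have /eqP := chart_transport hW Wx j.
  by rewrite addrC addr_eq0 /dotr => /eqP ->; rewrite mulrN mxE mulrC.
have -> : dotr (zeta.2.1 *: gradT F x.2 + v) (zeta.2.1 *: gradT F x.2 + v)
    = zeta.2.1 ^+ 2 * a + zeta.2.1 *+ 2 * dotr (gradT F x.2) v + dotr v v.
  rewrite /a /dotr !mulr_sumr -!big_split/=; apply: eq_bigr => j _.
  by rewrite !mxE; ring.
by rewrite orth; ring.
Qed.

End chart.

Section phases.
Context {R : realType} {n : nat}.
(* Y : domain of the coordinates y, p : symbol, phi : incoming phase,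
   rho : radius of the ball U *)
Variables (Y : set (x_space R n)) (p : tx_space R n -> tx_space R n -> R).
Variables (rho : R) (phi : tx_space R n -> R).

(* The curve s |-> (z s, zeta s) satisfies at s the equation of the integral
   curves of H_p = d_zeta p . d_z - d_z p . d_zeta. *)
Definition hamilton_at (z zeta : R -> tx_space R n) (s : R) : Prop :=
  [/\ Y (z s).2,
      is_derive s 1 z (gradtx (p (z s)) (zeta s)) &
      is_derive s 1 zeta (- gradtx (fun w => p w (zeta s)) (z s))].

Definition phase_ball : set (tx_space R n) :=
  [set z | sqnormtx z < rho ^+ 2].

Record incoming_phase : Prop := IncomingPhase {
  phase_rho : 0 < rho;
  phase_dom : forall z, phase_ball z -> Y z.2;
  phase_smooth : smooth_on phase_ball phi;
  phase_eikonal : forall z, phase_ball z -> p z (gradtx phi z) = 0;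
  phase_forward : forall z, phase_ball z -> (gradtx phi z).1 < 0;
  phase_at0 : phi 0 = 0;
  phase_grazing0 : (gradtx phi 0).2.1 = 0;
  phase_grazing_ray : exists (z zeta : R -> tx_space R n) (eps : R),
    [/\ 0 < eps, z 0 = 0, zeta 0 = gradtx phi 0,
        forall s, `|s| < eps -> hamilton_at z zeta s &
        forall s, 0 < `|s| < eps -> 0 < (z s).2.1]
}.

Definition grazing_set : set (tx_space R n) :=
  [set z | [/\ phase_ball z, z.2.1 = 0 & (gradtx phi z).2.1 = 0]].

Definition ray_field (z : tx_space R n) : tx_space R n :=
  gradtx (p z) (gradtx phi z).

(* closed ball of centre c and radius r in the hyperplane t = - T *)
Definition source (T : R) (c : x_space R n) (r : R) : set (tx_space R n) :=
  [set z | z.1 = - T /\ sqnormx (z.2 - c) <= r ^+ 2].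

Definition admissible_source (T : R) (c : x_space R n) (r : R) : Prop :=
  0 < r /\ forall z, source T c r z -> phase_ball z /\ 0 < z.2.1.

(* J_i *)
Definition incoming_flowout (T : R) (S : set (tx_space R n)) :
    set (tx_space R n) :=
  [set z | exists (gamma : R -> tx_space R n) (s : R),
    [/\ 0 <= s, S (gamma 0), gamma s = z &
        forall u, 0 <= u <= s ->
          [/\ phase_ball (gamma u), 0 <= (gamma u).2.1, (gamma u).1 <= T &
              is_derive u 1 gamma (ray_field (gamma u))]]].

Definition boundary_pt (w : R * tan_space R n) : tx_space R n :=
  (w.1, (0, w.2)).

(* V_r, as a set of points (t, y') *)
Definition reflect_set (T : R) (S : set (tx_space R n)) :
    set (R * tan_space R n) :=
  [set w | incoming_flowout T S (boundary_pt w)].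

(* V_r minus the grazing points *)
Definition reflect_set0 (T : R) (S : set (tx_space R n)) :
    set (R * tan_space R n) :=
  [set w | reflect_set T S w /\ ~ grazing_set (boundary_pt w)].

(* (d_t phi, - d_{y_1} phi, grad_{y'} phi) at the boundary point w *)
Definition reflected_covector (w : R * tan_space R n) : tx_space R n :=
  let g := gradtx phi (boundary_pt w) in (g.1, (- g.2.1, g.2.2)).

(* Parameters (s, w) with w in B and 0 <= s < s0, as long as the ray started
   at w stays in t <= T. *)
Definition flow_domain (T s0 : R) (Z : R * (R * tan_space R n) -> tx_space R n)
    (B : set (R * tan_space R n)) : set (R * (R * tan_space R n)) :=
  [set d | [/\ B d.2, 0 <= d.1 < s0 &
               forall u, 0 <= u <= d.1 -> (Z (u, d.2)).1 <= T]].

(* Z (s, w) is the position and Theta (s, w) the covector at parameter s of the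
   reflected bicharacteristic started at w. *)
Record reflected_flow (T s0 : R) (S : set (tx_space R n))
    (Z Theta : R * (R * tan_space R n) -> tx_space R n) : Prop :=
  ReflectedFlow {
  flow_init_pos : forall w, reflect_set T S w -> Z (0, w) = boundary_pt w;
  flow_init_cov : forall w, reflect_set T S w ->
    Theta (0, w) = reflected_covector w;
  flow_hamilton : forall d, flow_domain T s0 Z (reflect_set T S) d ->
    hamilton_at (fun s => Z (s, d.2)) (fun s => Theta (s, d.2)) d.1;
  flow_homeo : homeomorphism_on (flow_domain T s0 Z (reflect_set T S)) Z;
  flow_diffeo : diffeomorphism_on (flow_domain T s0 Z (reflect_set0 T S)) Z
}.

(* the range of Z off the grazing rays *)
Definition reflected_range0 (T s0 : R) (S : set (tx_space R n))
    (Z : R * (R * tan_space R n) -> tx_space R n) : set (tx_space R n) :=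
  Z @` flow_domain T s0 Z (reflect_set0 T S).

(* The range is not open, so phi_r stands for a C^infty function on an open
   neighbourhood of it; its gradient on the range is prescribed. *)
Record reflected_phase (T s0 : R) (S : set (tx_space R n))
    (Z Theta : R * (R * tan_space R n) -> tx_space R n)
    (phi_r : tx_space R n -> R) : Prop := ReflectedPhase {
  reflected_smooth : exists D : set (tx_space R n),
    [/\ open D, reflected_range0 T s0 S Z `<=` D & smooth_on D phi_r];
  reflected_val : forall d, flow_domain T s0 Z (reflect_set0 T S) d ->
    phi_r (Z d) = phi (boundary_pt d.2);
  reflected_grad : forall d, flow_domain T s0 Z (reflect_set0 T S) d ->
    gradtx phi_r (Z d) = Theta d
}.

End phases.

(* Main.v *)
From HB Require Import structures.
Require Import Defs.
From mathcomp Require Import all_boot all_order all_algebra.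
From mathcomp Require Import all_classical all_reals all_analysis.
From mathcomp Require Import ring lra.
Import Order.TTheory GRing.Theory Num.Theory.
Import numFieldNormedType.Exports.
Local Open Scope classical_set_scope.
Local Open Scope ring_scope.
Set Implicit Arguments.
Unset Strict Implicit.
Unset Printing Implicit Defensive.

(** Along a reflected ray, [d_{y_1} phi_r] is the covector component [eta_1].  It
    starts at [- d_{y_1} phi_i > 0], because the incoming ray reaches [y_1 = 0]
    from [y_1 > 0] and the point is not grazing.  Since [phi_r] is constant along
    the ray and [p] is homogeneous of degree 2 in the covector, Euler's identity
    gives [p = 0], that is [q = - eta_1 ^ 2], on the ray.  Put [N = (1, grad F)]
    and [a = |N|^2]; then [d_{y_1} = a^{-1} N . grad_x], and
    [q = (|grad g|^2 - tau^2) / a] where [g = eta' . G] satisfies the transport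
    equation [N . grad g = 0].  Differentiating that equation in the direction
    [w = grad g] gives [N . grad |grad g|^2 = - 2 D^2F(w', w')], which is
    nonpositive by convexity.  Hence [eta_1' = - d_{y_1} q >= - C eta_1 ^ 2] with
    [C] continuous along the ray, and [eta_1] cannot reach zero. *)

(** * Continuous partial derivatives and differentiability *)

Section directional_derivatives.
Context {R : realType} {V : normedModType R}.

(** Both difference quotients are the same function of [h], so derivatives along a line reduce to
    one-variable calculus. *)
Lemma is_derive_line {W : normedModType R} (f : V -> W) (y v : V) (t : R) (df : W) :
  is_derive (y + t *: v) v f df <->
  is_derive t (1 : R) (fun h => f (y + h *: v)) df.
Proof.
have E : (fun h => h^-1 *: ((f \o shift (y + t *: v)) (h *: v) - f (y + t *: v)))
  = (fun h => h^-1 *: (((fun h => f (y + h *: v)) \o shift t) (h *: (1 : R))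
        - f (y + t *: v))).
  apply/funext => h /=; congr (_ *: (f _ - _)).
  by rewrite -[h *: 1]/(h * 1) mulr1 scalerDl addrCA.
by split=> -[]; rewrite /derivable /derive ?E => ? ?; split;
   rewrite /derivable /derive ?E.
Qed.

Lemma line_mean_value (f : V -> R) (y v : V) (t : R) :
  (forall u, `|u| <= `|t| -> derivable f (y + u *: v) v) ->
  exists2 u, `|u| <= `|t| & f (y + t *: v) - f y = t * 'D_v f (y + u *: v).
Proof.
move=> df; pose g h := f (y + h *: v).
have dg u : `|u| <= `|t| -> is_derive u (1 : R) g ('D_v f (y + u *: v)).
  by move=> ut; apply/is_derive_line; apply: DeriveDef => //; exact: df.
have g0 : g 0 = f y by rewrite /g scale0r addr0.
have cg (a b : R) : {in `[a, b], forall u, `|u| <= `|t|} ->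
    {within `[a, b], continuous g}.
  move=> ab; apply: derivable_within_continuous => u uab.
  by have [] := dg u (ab u uab).
case: (leP 0 t) => t0.
- have ab : {in `[0, t], forall u, `|u| <= `|t|}.
    by move=> u; rewrite in_itv/= => /andP[u0 ut]; rewrite !ger0_norm.
  have [||u ut E] := @MVT_segment R g (fun u => 'D_v f (y + u *: v)) 0 t t0.
  + by move=> u uI; apply/dg/ab/subset_itv_oo_cc.
  + exact: cg.
  by exists u; [exact: ab|rewrite -g0 E subr0 mulrC].
- have ab : {in `[t, 0], forall u, `|u| <= `|t|}.
    move=> u; rewrite in_itv/= => /andP[u0 ut].
    by rewrite !ler0_norm ?lerN2// ltW.
  have [||u ut E] := @MVT_segment R g (fun u => 'D_v f (y + u *: v)) t 0 (ltW t0).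
  + by move=> u uI; apply/dg/ab/subset_itv_oo_cc.
  + exact: cg.
  exists u; first exact: ab.
  by rewrite -g0 -opprB E sub0r mulrN opprK mulrC.
Qed.

(** The mean value theorem turns the increment into [t] times a derivative at a nearby point. The
    base point [y] may move, so that increments in successive coordinate directions can be added. *)
Lemma line_increment_near (f : V -> R) (x e : V) (eps : R) : 0 < eps ->
  (\forall y \near x, derivable f y e) ->
  {for x, continuous (fun y => 'D_e f y)} ->
  exists2 d, 0 < d & forall y t, `|y - x| + `|t *: e| < d ->
    `|f (y + t *: e) - f y - t * 'D_e f x| <= eps * `|t|.
Proof.
move=> e0 df cf.
have /nbhs_ballP[d d0 dP] : \forall y \near x,
    derivable f y e /\ `|'D_e f x - 'D_e f y| < eps.
  by near=> y; split; near: y => //; move/cvgrPdist_lt : cf; exact.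
exists d => // y t ytd.
have dy u : `|u| <= `|t| -> ball x d (y + u *: e).
  move=> ut; rewrite -ball_normE /= -normrN opprB addrAC.
  apply: le_lt_trans (ler_normD _ _) (le_lt_trans _ ytd).
  by rewrite lerD2l !normrZ ler_wpM2r.
have [u ut|u ut ->] := @line_mean_value f y e t.
  by have [] := dP _ (dy u ut).
rewrite -mulrBr normrM mulrC ler_wpM2r// distrC ltW//.
by have [] := dP _ (dy u ut).
Unshelve. all: by end_near. Qed.

Section frechet.
Context {m : nat} (c : 'I_m -> V -> R) (e : 'I_m -> V).
Hypothesis c_lin : forall i, linear (c i : V -> R^o).
Hypothesis c_le : forall v i, `|c i v| <= `|v|.
Hypothesis c_e : forall v, v = \sum_i c i v *: e i.

Lemma coordinates_linear_continuous (L : V -> R^o) : linear L -> continuous L.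
Proof.
move=> L_lin.
pose LM := GRing.isLinear.Build _ _ _ _ _ L_lin.
pose LL : {linear V -> R^o} := HB.pack L LM.
apply/(linear_bounded_continuous LL)/linear_boundedP.
exists (\sum_i `|L (e i)|); split=> [|b /ltW bM v]; first exact: num_real.
rewrite (@le_trans _ _ ((\sum_i `|L (e i)|) * `|v|))//; last by rewrite ler_wpM2r.
rewrite [in leLHS](c_e v) (raddf_sum LL) mulr_suml.
rewrite (le_trans (ler_norm_sum _ _ _))//; apply: ler_sum => i _.
rewrite [X in `|X|](_ : _ = c i v * L (e i)); last exact: (linearZZ LL).
by rewrite normrM [leRHS]mulrC; apply: ler_wpM2r.
Qed.

(** Coordinates are changed one at a time, each change costing an error of at most [eps] times the
    norm of [v]; hence the factor [size r]. *)
Let increment_seq (f : V -> R) (x : V) (r : seq 'I_m) (eps : R) : 0 < eps ->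
  (forall i, \forall y \near x, derivable f y (e i)) ->
  (forall i, {for x, continuous (fun y => 'D_(e i) f y)}) ->
  exists2 d, 0 < d & forall v, `|v| < d ->
   `|f (x + \sum_(i <- r) c i v *: e i) - f x - \sum_(i <- r) c i v * 'D_(e i) f x|
   <= (eps *+ size r) * `|v|.
Proof.
move=> e0 df cf; elim: r => [|i r [d d0 IH]].
  exists 1 => // v _.
  by rewrite !big_nil addr0 subrr subr0 normr0 mul0r.
have [d' d'0 H] := line_increment_near e0 (df i) (cf i).
(* Chosen so that [C] times the norm of [v] bounds the distance from [y] to [x] plus the length of
   the next step; the summand 1 makes [C] positive. *)
pose C := 1 + (\sum_(i <- r) `|e i| + `|e i|).
have C0 : 0 < C by rewrite /C ltr_pwDl// addr_ge0// sumr_ge0.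
exists (Num.min d (d' / C)).
  by rewrite lt_min d0/= divr_gt0.
move=> v; rewrite lt_min => /andP[vd]; rewrite ltr_pdivlMr// => vd'.
rewrite !big_cons [c i v *: _ + _]addrC addrA.
set y := x + _.
have yd : `|y - x| + `|c i v *: e i| < d'.
  rewrite (le_lt_trans _ vd')// /C mulrC mulrDl mul1r ler_wpDl// mulrDl.
  rewrite lerD//; last by rewrite normrZ [leRHS]mulrC; apply: ler_wpM2r.
  rewrite /y addrAC subrr add0r mulr_suml (le_trans (ler_norm_sum _ _ _))//.
  by apply: ler_sum => j _; rewrite normrZ [leRHS]mulrC; apply: ler_wpM2r.
have -> : f (y + c i v *: e i) - f x -
    (c i v * 'D_(e i) f x + \sum_(j <- r) c j v * 'D_(e j) f x) =
  (f (y + c i v *: e i) - f y - c i v * 'D_(e i) f x) +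
  (f y - f x - \sum_(j <- r) c j v * 'D_(e j) f x) by ring.
rewrite (le_trans (ler_normD _ _))//= mulrS mulrDl lerD//.
  by rewrite (le_trans (H _ _ yd))// ler_wpM2l// ltW.
exact: IH.
Qed.

(** The candidate [L] combines the partial derivatives; [increment_seq] over all coordinates gives
    the little-o estimate, and uniqueness identifies [L] with the differential. *)
Lemma differentiable_continuous_partial (f : V -> R) (x : V) :
  (forall i, \forall y \near x, derivable f y (e i)) ->
  (forall i, {for x, continuous (fun y => 'D_(e i) f y)}) ->
  differentiable f x.
Proof.
move=> df cf.
pose L v : R := \sum_i c i v * 'D_(e i) f x.
have L_lin : linear (L : V -> R^o).
  move=> a u v; rewrite /L scaler_sumr -big_split /=; apply: eq_bigr => i _.
  by rewrite c_lin mulrDl -mulrA.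
pose LM := GRing.isLinear.Build _ _ _ _ _ L_lin.
pose LL : {linear V -> R^o} := HB.pack (L : V -> R^o) LM.
have LC : continuous LL by exact: coordinates_linear_continuous.
have LE : f \o shift x = cst (f x) + LL +o_ 0 id.
  apply/eqaddoP => eps e0.
  (* The division keeps the accumulated error within [eps] times the norm; the successor keeps the
     divisor nonzero even without coordinates. *)
  have [|d d0 H] := increment_seq (index_enum 'I_m) (f := f) (x := x)
    (eps := eps / (size (index_enum 'I_m)).+1%:R) _ df cf.
    by rewrite divr_gt0.
  near=> v => /=.
  have vd : `|v| < d by near: v; apply: nbhs0_lt.
  have := H v vd.
  rewrite -c_e => Hv.
  suff -> : (f \o shift x - (cst (f x) + LL)) v =
      f (x + v) - f x - \sum_i c i v * 'D_(e i) f x.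
    apply: (le_trans Hv); rewrite ler_wpM2r// -[_ *+ size _]mulr_natr -mulrA.
    rewrite ler_piMr ?ltW//.
    by rewrite mulrC ltr_pdivrMr// mul1r ltr_nat.
  by rewrite -addrA -opprD [x + v]addrC.
have E := diff_unique LC LE.
by apply/diff_locallyP; rewrite E; split.
Unshelve. all: by end_near. Qed.
End frechet.
End directional_derivatives.

(** * Finite-dimensional normed spaces *)

Section finite_coordinates.
Context {R : realType}.

(** The bound with constant 1 fits the sup norms on rows and pairs. *)
Definition finite_coordinates (V : normedModType R) :=
  exists m (c : 'I_m -> V -> R) (e : 'I_m -> V),
    [/\ forall i, linear (c i : V -> R^o),
        forall v i, `|c i v| <= `|v| &
        forall v, v = \sum_i c i v *: e i].

Lemma finite_coordinates_row n : finite_coordinates 'rV[R]_n.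
Proof.
exists n, (fun i (v : 'rV[R]_n) => v 0 i), (fun i => delta_mx 0 i); split.
- by move=> i a u v; rewrite !mxE.
- move=> v i; rewrite [leRHS]/Num.Def.normr/= mx_normrE.
  exact: (le_bigmax _ (fun ij : 'I_1 * 'I_n => `|v ij.1 ij.2|) (0, i)).
- exact: row_sum_delta.
Qed.

Lemma finite_coordinates_pair (V : normedModType R) :
  finite_coordinates V -> finite_coordinates (R * V)%type.
Proof.
move=> [m [c [e [cl cle cE]]]].
exists m.+1, (fun i v => oapp (fun j => c j v.2) v.1 (unlift ord0 i)),
  (fun i => oapp (fun j => (0, e j)) (1, 0) (unlift ord0 i)); split.
- move=> i a u v; case: unliftP => [j _|_] //=.
  by rewrite cl.
- move=> v i; rewrite prod_normE le_max; case: unliftP => [j _|_] /=.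
    by rewrite cle orbT.
  by rewrite lexx.
- move=> [a v]; rewrite big_ord_recl unlift_none /=.
  under eq_bigr do rewrite liftK /=.
  apply: injective_projections => /=.
    rewrite raddf_sum big1/= => [|i _]; last by rewrite [LHS]mulr0.
    by rewrite addr0 [RHS]mulr1.
  by rewrite raddf_sum/= scaler0 add0r.
Qed.

Lemma finite_coordinates_linear_continuous (V : normedModType R) (L : V -> R^o) :
  finite_coordinates V -> linear L -> continuous L.
Proof.
by move=> [m [c [e [_ cle cE]]]]; exact: (coordinates_linear_continuous cle cE).
Qed.

Lemma finite_coordinates_x n : finite_coordinates (x_space R n).
Proof. exact/finite_coordinates_pair/finite_coordinates_row. Qed.

Lemma finite_coordinates_tx n : finite_coordinates (tx_space R n).
Proof. exact/finite_coordinates_pair/finite_coordinates_x. Qed.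

End finite_coordinates.

(** * Smooth functions and symmetry of mixed derivatives *)

Section smooth_functions.
Context {R : realType} {V : normedModType R}.

(** [iterD] applies the last vector of its list first, so differentiating [f] beforehand appends to
    the list. *)
Lemma iterD_rcons {W : normedModType R} (f : V -> W) vs v :
  Defs.iterD (rcons vs v) f = Defs.iterD vs (fun x => 'D_v f x).
Proof. by elim: vs => //= w vs ->. Qed.

Lemma smooth_on_derive {W : normedModType R} (D : set V) (f : V -> W) v :
  smooth_on D f -> smooth_on D (fun x => 'D_v f x).
Proof. by move=> sf vs x Dx; rewrite -iterD_rcons; exact: sf. Qed.

Lemma smooth_on_continuous {W : normedModType R} (D : set V) (f : V -> W) x :
  smooth_on D f -> D x -> {for x, continuous f}.
Proof. by move=> sf Dx; have [] := sf [::] x Dx. Qed.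

Lemma smooth_on_derivable {W : normedModType R} (D : set V) (f : V -> W) x v :
  smooth_on D f -> D x -> derivable f x v.
Proof. by move=> sf Dx; have [_] := sf [::] x Dx; exact. Qed.

Lemma smooth_on_differentiable (D : set V) (f : V -> R) x :
  finite_coordinates V -> open D -> smooth_on D f -> D x ->
  differentiable f x.
Proof.
move=> [m [c [e [cl cle cE]]]] oD sf Dx.
apply: (differentiable_continuous_partial cl cle cE) => i.
  apply: filterS (open_nbhs_nbhs (conj oD Dx)) => y Dy.
  exact: smooth_on_derivable sf Dy.
exact: (smooth_on_continuous (smooth_on_derive (e i) sf) Dx).
Qed.

Lemma is_derive_comp_curve {W : normedModType R} (f : V -> W) (c : R -> V) (s : R) (v : V) :
  differentiable f (c s) -> is_derive s (1 : R) c v ->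
  is_derive s (1 : R) (f \o c) ('D_v f (c s)).
Proof.
move=> df [dc cv].
have dc' : differentiable c s by exact/derivable1_diffP.
have dfc : differentiable (f \o c) s by exact: differentiable_comp.
split; first exact: diff_derivable.
by rewrite deriveE// diff_comp//= -(deriveE _ dc') cv -deriveE.
Qed.

Lemma is_derive_translate {W : normedModType R} (f : V -> W) (y a v : V) df :
  is_derive (y + a) v f df -> is_derive y v (fun z => f (z + a)) df.
Proof.
have E : (fun h => h^-1 *: ((f \o shift (y + a)) (h *: v) - f (y + a)))
  = (fun h => h^-1 *: (((fun z => f (z + a)) \o shift y) (h *: v) - f (y + a))).
  by apply/funext => h /=; rewrite addrA.
by case=> ? ?; split; rewrite /derivable /derive -?E.
Qed.

(** Two uses of the mean value theorem: for [f (y + t *: v) - f y] in direction [u], then for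
    ['D_u f] in direction [v]. *)
Lemma second_difference (f : V -> R) (x u v : V) (t : R) :
  (forall a b, `|a| <= `|t| -> `|b| <= `|t| ->
    derivable f (x + a *: u + b *: v) u /\
    derivable (fun y => 'D_u f y) (x + a *: u + b *: v) v) ->
  exists a b, [/\ `|a| <= `|t|, `|b| <= `|t| &
    f (x + t *: u + t *: v) - f (x + t *: u) - f (x + t *: v) + f x
    = t * (t * 'D_v (fun y => 'D_u f y) (x + a *: u + b *: v))].
Proof.
move=> H; pose g y := f (y + t *: v) - f y.
have dg a : `|a| <= `|t| -> is_derive (x + a *: u) u g
    ('D_u f (x + a *: u + t *: v) - 'D_u f (x + a *: u)).
  move=> at_; apply: is_deriveB.
    apply: is_derive_translate; apply: derivableP.
    exact: (H a t at_ (lexx _)).1.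
  apply: derivableP.
  have := H a 0 at_; rewrite normr0 scale0r addr0 => Ha.
  exact: (Ha (normr_ge0 _)).1.
have [|a at_ E] := @line_mean_value R V g x u t.
  by move=> a /dg[].
have [|b bt E'] := @line_mean_value R V (fun y => 'D_u f y) (x + a *: u) v t.
  by move=> b bt; exact: (H a b at_ bt).2.
exists a, b; split => //.
rewrite -E' -(@derive_val _ _ _ _ _ _ _ (dg a at_)) -E /g.
by rewrite opprB addrA addrAC.
Qed.

(** This accommodates mean value points: the two functions need to share a value only at two
    possibly different points close to [x]. *)
Lemma eq_of_common_values (g h : V -> R) (x : V) :
  {for x, continuous g} -> {for x, continuous h} ->
  (forall d, 0 < d -> exists y z, [/\ ball x d y, ball x d z & g y = h z]) ->
  g x = h x.
Proof.
move=> cg ch gh; apply/eqP; rewrite -subr_eq0 -normr_le0; apply/ler_addgt0Pr.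
move=> eps e0; rewrite add0r.
have e20 : 0 < eps / 2 by rewrite divr_gt0.
move/cvgrPdist_lt/(_ _ e20) : cg => ng.
move/cvgrPdist_lt/(_ _ e20) : ch => nh.
have [d d0 dP] := (nbhs_ballP _ _).1 (filterI ng nh).
have [y [z [/dP[Hy _] /dP[_ Hz] E]]] := gh d d0.
rewrite (splitr eps) -(subrKA (g y)) (le_trans (ler_normD _ _))//.
by rewrite lerD// ltW// E distrC.
Qed.

Let cancel_squares (t X A B : R) : t != 0 ->
  X = t * (t * A) -> X = t * (t * B) -> A = B.
Proof. by move=> t0 -> /(mulfI t0)/(mulfI t0). Qed.

(** The second difference is symmetric in [u] and [v]; computing it in both orders gives a common
    value of the two mixed derivatives arbitrarily close to [x], and continuity concludes. *)
Lemma derive_commute (f : V -> R) (D : set V) (x u v : V) :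
  open D -> smooth_on D f -> D x ->
  'D_u (fun y => 'D_v f y) x = 'D_v (fun y => 'D_u f y) x.
Proof.
move=> oD sf Dx.
have su := smooth_on_derive u sf; have sv := smooth_on_derive v sf.
apply: (eq_of_common_values (smooth_on_continuous (smooth_on_derive u sv) Dx)
  (smooth_on_continuous (smooth_on_derive v su) Dx)) => d d0.
have [d' d'0 d'P] := (nbhs_ballP _ _).1 (open_nbhs_nbhs (conj oD Dx)).
pose r := Num.min d d'.
have r0 : 0 < r by rewrite lt_min d0.
(* Small enough that the whole parallelogram of points [x + a *: u + b *: v] with coefficients
   bounded by [t] lies within [r] of [x]; the 1 makes the bound strict. *)
pose t := r / (1 + `|u| + `|v|).
have C0 : 0 < 1 + `|u| + `|v| by rewrite -addrA ltr_pwDl.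
have t0 : 0 < t by rewrite divr_gt0.
have near_x a b : `|a| <= `|t| -> `|b| <= `|t| -> ball x r (x + a *: u + b *: v).
  move=> at_ bt; rewrite -ball_normE /= -addrA opprD addrA subrr add0r normrN.
  rewrite (le_lt_trans (ler_normD _ _))// !normrZ.
  have -> : r = `|t| * (1 + `|u| + `|v|).
    by rewrite gtr0_norm// divfK// gt_eqF.
  rewrite !mulrDr mulr1 -addrA ltr_pwDl ?normr_gt0 ?gt_eqF//.
  by rewrite lerD// ler_wpM2r.
have near_D a b : `|a| <= `|t| -> `|b| <= `|t| -> D (x + a *: u + b *: v).
  move=> at_ bt; apply: d'P; apply: le_ball (near_x _ _ at_ bt).
  by rewrite ge_min lexx orbT.
have [|a [b [at_ bt E]]] := @second_difference f x u v t.
  move=> a b at_ bt; have Dy := near_D _ _ at_ bt.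
  split; [exact: smooth_on_derivable sf Dy|exact: smooth_on_derivable su Dy].
have [|a' [b' [at' bt' E']]] := @second_difference f x v u t.
  move=> a' b' at' bt'; rewrite addrAC; have Dy := near_D _ _ bt' at'.
  split; [exact: smooth_on_derivable sf Dy|exact: smooth_on_derivable sv Dy].
exists (x + b' *: u + a' *: v), (x + a *: u + b *: v); split.
- apply: le_ball (near_x _ _ bt' at'); by rewrite ge_min lexx.
- apply: le_ball (near_x _ _ at_ bt); by rewrite ge_min lexx.
- have EX : f (x + t *: v + t *: u) - f (x + t *: v) - f (x + t *: u) + f x =
    f (x + t *: u + t *: v) - f (x + t *: u) - f (x + t *: v) + f x.
    by rewrite [x + t *: u + t *: v]addrAC; ring.
  rewrite EX in E'; rewrite [x + b' *: u + _]addrAC.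
  exact: (cancel_squares (lt0r_neq0 t0) E' E).
Qed.

End smooth_functions.

(** * Second derivatives of convex functions *)

Section convexity.
Context {R : realType} {V : normedModType R}.

Lemma convex_midpoint (f : V -> R) (x h : V) :
  convex_function setT f -> 0 <= f (x + h) - f x - f x + f (x - h).
Proof.
have h0 : (0 : R) <= 2^-1 by rewrite invr_ge0.
have h1 : (2^-1 : R) <= 1 by rewrite invf_le1// ler1n.
move=> cf; have := cf (Itv01 h0 h1) (x + h) (x - h) (in_setT _) (in_setT _).
rewrite convRE /= /conv /= /unstable.onem.
have -> : 1 - 2^-1 = 2^-1 :> R by field.
have -> : 2^-1 *: (x + h) + 2^-1 *: (x - h) = x.
  rewrite -scalerDr addrACA subrr addr0 -mulr2n -[x *+ 2]scaler_nat scalerA.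
  by rewrite mulVf// scale1r.
lra.
Qed.

(** A negative second derivative at [x] would stay negative nearby, making a small symmetric second
    difference negative, against [convex_midpoint]. *)
Lemma convex_derive2_ge0 (f : V -> R) (x v : V) :
  convex_function setT f -> smooth_on setT f ->
  0 <= 'D_v (fun y => 'D_v f y) x.
Proof.
move=> cf sf; rewrite leNgt; apply/negP => lt0.
have sv := smooth_on_derive v sf.
have cvv := smooth_on_continuous (smooth_on_derive v sv) (I : [set: V] x).
have [d d0 dP] := (nbhs_ballP _ _).1 (cvv _ (lt_nbhsl lt0)).
(* The mean value point is displaced from [x] by [- t *: v + a *: v + b *: v], three terms each no
   longer than [t *: v]. *)
pose t := d / (1 + `|v| *+ 3).
have C0 : 0 < 1 + `|v| *+ 3 by rewrite ltr_pwDl// mulrn_wge0.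
have t0 : 0 < t by rewrite divr_gt0.
(* Starting from [x - t *: v] centres the second difference at [x]. *)
have [|a [b [at_ bt E]]] := @second_difference R V f (x - t *: v) v v t.
  move=> a b _ _; split.
    exact: smooth_on_derivable sf _.
  exact: smooth_on_derivable sv _.
have := convex_midpoint x (t *: v) cf.
rewrite subrK in E; rewrite E leNgt => /negP; apply.
rewrite (pmulr_rlt0 _ t0) (pmulr_rlt0 _ t0); apply: dP.
rewrite -ball_normE /= !opprD !addrA subrr add0r opprK.
have -> : d = `|t| * (1 + `|v| *+ 3) by rewrite gtr0_norm// divfK// gt_eqF.
rewrite mulrDr mulr1 ltr_pwDl ?normr_gt0 ?gt_eqF//.
rewrite -!scaleNr -!scalerDl normrZ mulrnAr -mulrnAl ler_wpM2r//.
rewrite !mulrS mulr0n addr0 addrA (le_trans (ler_normD _ _))// lerD ?normrN//.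
by rewrite (le_trans (ler_normD _ _))// lerD ?normrN.
Qed.

End convexity.

(** * Linear images and gradients *)

Section difference_quotients.
Context {R : realType} {V W : normedModType R}.

Lemma is_derive_cvg (f : V -> W) (x v : V) (df : W) :
  is_derive x v f df ->
  (fun h => h^-1 *: ((f \o shift x) (h *: v) - f x)) @ 0^' --> df.
Proof. by case=> H <-. Qed.

Lemma cvg_is_derive (f : V -> W) (x v : V) (df : W) :
  (fun h => h^-1 *: ((f \o shift x) (h *: v) - f x)) @ 0^' --> df ->
  is_derive x v f df.
Proof. by move=> H; split; [apply/cvg_ex; exists df|exact: cvg_lim H]. Qed.

End difference_quotients.

Section linear_images.
Context {R : realType} {V W : normedModType R}.

Lemma is_derive_pair {W' : normedModType R} (f : V -> W) (g : V -> W')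
    (x v : V) (df : W) (dg : W') :
  is_derive x v f df -> is_derive x v g dg ->
  is_derive x v (fun y => (f y, g y)) (df, dg).
Proof.
move=> /is_derive_cvg Hf /is_derive_cvg Hg; apply: cvg_is_derive.
exact: (cvg_pair Hf Hg).
Qed.

(** A linear form commutes with difference quotients and, being continuous in finite dimension, with
    their limit. *)
Lemma is_derive_comp_linear (L : W -> R^o) (f : V -> W) (x v : V) (df : W) :
  finite_coordinates W -> linear L ->
  is_derive x v f df -> is_derive x v (fun y => L (f y) : R) (L df).
Proof.
move=> fW lL /is_derive_cvg Hf; apply: cvg_is_derive.
have cL := finite_coordinates_linear_continuous fW lL.
have LB a b : L (a - b) = L a - L b.
  by rewrite -scaleN1r addrC lL scaleN1r addrC.
have L0 : L 0 = 0 by rewrite -(subrr 0) LB subrr.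
have LZ a u : L (a *: u) = a *: L u by rewrite -[a *: u]addr0 lL L0 addr0.
have -> : (fun h => h^-1 *: (((fun y => L (f y) : R) \o shift x) (h *: v) - L (f x)))
    = (fun h => L (h^-1 *: ((f \o shift x) (h *: v) - f x))).
  by apply/funext => h /=; rewrite LZ LB.
by apply: continuous_cvg Hf; exact: cL.
Qed.

Lemma derive_comp_linear (L : W -> R^o) (f : V -> W) (x v : V) :
  finite_coordinates W -> linear L -> derivable f x v ->
  'D_v (fun y => L (f y) : R) x = L ('D_v f x).
Proof.
move=> fW lL df; apply: (@derive_val _ _ _ _ _ _ _ _).
by apply: is_derive_comp_linear => //; exact: derivableP.
Qed.

Lemma near_open (D : set V) (x : V) : open D -> D x -> \forall y \near x, D y.
Proof. by move=> oD Dx; exact: open_nbhs_nbhs. Qed.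

Lemma iterD_comp_linear (L : W -> R^o) (D : set V) (f : V -> W) vs (x : V) :
  finite_coordinates W -> linear L -> open D -> smooth_on D f -> D x ->
  Defs.iterD vs (fun y => L (f y) : R) x = L (Defs.iterD vs f x).
Proof.
move=> fW lL oD sf; elim: vs x => //= v vs IH x Dx.
rewrite -derive_comp_linear//; last by have [_] := sf vs x Dx; exact.
by apply: near_eq_derive; apply: filterS (near_open oD Dx) => y /IH.
Qed.

(** The iterated derivatives of the composite are the [L]-images of those of [f] on [D]; as [D] is
    open, this holds near each point and transfers continuity and derivability. *)
Lemma smooth_on_comp_linear (L : W -> R^o) (D : set V) (f : V -> W) :
  finite_coordinates W -> linear L -> open D -> smooth_on D f ->
  smooth_on D (fun y => L (f y) : R).
Proof.
move=> fW lL oD sf vs x Dx.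
have E : \forall y \near x,
    L (Defs.iterD vs f y) = Defs.iterD vs (fun y => L (f y) : R) y.
  apply: filterS (near_open oD Dx) => y Dy.
  by rewrite (iterD_comp_linear _ fW lL oD sf Dy).
have [cf df] := sf vs x Dx.
have cL := finite_coordinates_linear_continuous fW lL.
split.
  have Ex := iterD_comp_linear vs fW lL oD sf Dx.
  have C : (fun y => L (Defs.iterD vs f y)) @ x --> L (Defs.iterD vs f x).
    by apply: continuous_cvg cf; exact: cL.
  by rewrite /prop_for /continuous_at Ex; apply: cvg_trans (near_eq_cvg E) C.
move=> v; apply: near_eq_derivable E _.
by have [] := is_derive_comp_linear fW lL (derivableP (df v)).
Qed.

End linear_images.

Section linear_projections.
Context {R : realType}.

Lemma linear_dotr m (u : 'rV[R]_m) : linear ((fun v => dotr v u) : 'rV[R]_m -> R^o).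
Proof.
move=> a v w; rewrite /dotr scaler_sumr -big_split/=.
by apply: eq_bigr => j _; rewrite !mxE mulrDl -mulrA.
Qed.

Lemma linear_coord m (j : 'I_m) : linear ((fun v => v 0 j) : 'rV[R]_m -> R^o).
Proof. by move=> a v w; rewrite !mxE. Qed.

Lemma linear_fst (V : normedModType R) : linear (fst : R * V -> R^o).
Proof. by []. Qed.

Lemma linear_snd_coord m (j : 'I_m) :
  linear ((fun v => v.2 0 j) : R * 'rV[R]_m -> R^o).
Proof. by move=> a v w; rewrite !mxE. Qed.

Lemma dotrC m (u v : 'rV[R]_m) : dotr u v = dotr v u.
Proof. by apply: eq_bigr => j _; rewrite mulrC. Qed.

Lemma is_derive_snd (V W : normedModType R) (f : V -> W) (z v : R * V) df :
  is_derive z.2 v.2 f df -> is_derive z v (fun w => f w.2) df.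
Proof. by move=> /is_derive_cvg ?; apply: cvg_is_derive. Qed.

Lemma derive_gradT n (f : tan_space R n -> R) (x v : tan_space R n) :
  differentiable f x -> 'D_v f x = dotr v (gradT f x).
Proof.
move=> df; rewrite deriveE// {1}[v]row_sum_delta linear_sum; apply: eq_bigr => j _.
by rewrite linearZ /= mxE deriveE.
Qed.

Lemma derive_gradx n (f : x_space R n -> R) (x v : x_space R n) :
  differentiable f x ->
  'D_v f x = v.1 * (gradx f x).1 + dotr v.2 (gradx f x).2.
Proof.
move=> df; have vE : v = v.1 *: (1, 0) + \sum_j v.2 0 j *: (0, delta_mx 0 j).
  apply: injective_projections => /=.
    rewrite raddf_sum big1/= => [|i _]; last by rewrite [LHS]mulr0.
    by rewrite addr0 [RHS]mulr1.
  by rewrite raddf_sum/= scaler0 add0r {1}[v.2]row_sum_delta.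
rewrite {1}vE deriveE// linearD linearZ linear_sum /=; congr (_ * _ + _).
  by rewrite deriveE.
by apply: eq_bigr => j _; rewrite linearZ /= mxE deriveE.
Qed.

End linear_projections.

(** * The symbol along the normal variable *)

Section calculus.
Context {R : realType} {V : normedModType R}.
Implicit Types (f g : V -> R).

Lemma is_derive_fsum (I : finType) (h : I -> V -> R) (dh : I -> R) (x v : V) :
  (forall i, is_derive x v (h i) (dh i)) ->
  is_derive x v (fun z => \sum_i h i z) (\sum_i dh i).
Proof.
move=> H; elim: (index_enum I) => [|i r IH].
  under eq_fun do rewrite big_nil.
  by rewrite big_nil; exact: is_derive_cst.
under eq_fun do rewrite big_cons.
by rewrite big_cons; exact: is_deriveD.
Qed.

Lemma is_derive_mul f g (x v : V) (df dg : R) :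
  is_derive x v f df -> is_derive x v g dg ->
  is_derive x v (fun z => f z * g z) (f x * dg + g x * df).
Proof. by move=> Hf Hg; exact: is_deriveM. Qed.

Lemma is_derive_sqr f (x v : V) (df : R) :
  is_derive x v f df -> is_derive x v (fun z => f z ^+ 2) (2 * f x * df).
Proof.
move=> Hf; under eq_fun do rewrite expr2.
by apply: is_derive_eq (is_derive_mul Hf Hf) _; ring.
Qed.

Lemma is_derive_quot f g (x v : V) (df dg : R) : g x != 0 ->
  is_derive x v f df -> is_derive x v g dg ->
  is_derive x v (fun z => f z / g z) ((df * g x - f x * dg) / g x ^+ 2).
Proof.
move=> gx0 Hf [dG gE].
have Hg : is_derive x v (fun z => (g z)^-1) (- (g x) ^- 2 *: dg).
  split; first exact: derivableV.
  by rewrite -gE; exact: deriveV.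
apply: is_derive_eq (is_derive_mul Hf Hg) _.
by rewrite -[_ *: dg]/(_ * dg); field.
Qed.

Lemma differentiable_fsum (I : finType) (h : I -> V -> R) (x : V) :
  (forall i, differentiable (h i) x) -> differentiable (fun z => \sum_i h i z) x.
Proof.
move=> H; elim: (index_enum I) => [|i r IH].
  under eq_fun do rewrite big_nil.
  exact: differentiable_cst.
under eq_fun do rewrite big_cons.
exact: differentiableD.
Qed.

Lemma differentiable_sqr f (x : V) :
  differentiable f x -> differentiable (fun z => f z ^+ 2) x.
Proof.
move=> df; under eq_fun do rewrite expr2.
exact: differentiableM.
Qed.

Lemma differentiable_snd_comp (f : V -> R) (z : R * V) :
  differentiable f z.2 -> differentiable (fun w : R * V => f w.2) z.
Proof.
have snd_lin : linear (snd : R * V -> V) by [].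
pose sndM := GRing.isLinear.Build _ _ _ _ _ snd_lin.
pose sndL : {linear (R * V)%type -> V} := HB.pack (snd : R * V -> V) sndM.
move=> df; apply: (@differentiable_comp _ _ _ _ sndL f) => //.
by apply: linear_differentiable => y; exact: cvg_snd.
Qed.

End calculus.

(** * Normal derivative of the symbol in the boundary chart *)

Section boundary.
Context {R : realType} {n : nat} (F : tan_space R n -> R).
Hypothesis F_smooth : smooth_on setT F.

(** The gradient of [y_1 = x_1 + F x'], used as a direction; the chart maps it to a multiple of the
    [y_1] direction. *)
Definition normal (x : x_space R n) : x_space R n := (1, gradT F x.2).

Definition normal_sqnorm (u : tan_space R n) : R := 1 + dotr (gradT F u) (gradT F u).

(** The Hessian form of [F] on its own gradient, which is half the derivative of [normal_sqnorm]
    along that gradient. *)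
Definition hessian_gradient (u : tan_space R n) : R :=
  \sum_k gradT F u 0 k * 'D_(gradT F u) (fun w => 'D_(delta_mx 0 k) F w) u.

Lemma normal_sqnorm_gt0 u : 0 < normal_sqnorm u.
Proof.
by rewrite ltr_pwDl// sumr_ge0// => j _; rewrite -expr2 sqr_ge0.
Qed.

Lemma differentiable_F u : differentiable F u.
Proof.
exact: (smooth_on_differentiable (finite_coordinates_row _) openT F_smooth).
Qed.

Lemma differentiable_DF v u : differentiable (fun w => 'D_v F w) u.
Proof.
exact: (smooth_on_differentiable (finite_coordinates_row _) openT
  (smooth_on_derive v F_smooth)).
Qed.

Lemma is_derive_DF v u w :
  is_derive u w (fun z => 'D_v F z) ('D_w (fun z => 'D_v F z) u).
Proof. exact/derivableP/diff_derivable/differentiable_DF. Qed.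

Lemma derive_DF_gradient v u :
  'D_v (fun w => 'D_v F w) u =
  \sum_k v 0 k * 'D_v (fun w => 'D_(delta_mx 0 k) F w) u.
Proof.
apply: derive_val; under eq_fun do rewrite (derive_gradT _ (differentiable_F _)).
apply: is_derive_fsum => k.
have -> : (fun z => v 0 k * gradT F z 0 k) =
    (fun z => cst (v 0 k) z * 'D_(delta_mx 0 k) F z).
  by apply/funext => z; rewrite mxE.
apply: is_derive_eq (is_derive_mul (is_derive_cst _ _ _) (is_derive_DF _ _ _)) _.
by rewrite mulr0 addr0.
Qed.

Lemma normal_sqnormE :
  normal_sqnorm = (fun w => 1 + \sum_k ('D_(delta_mx 0 k) F w) ^+ 2).
Proof.
apply/funext => w; congr (_ + _).
by apply: eq_bigr => k _; rewrite !mxE expr2.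
Qed.

Lemma is_derive_normal_sqnorm u :
  is_derive u (gradT F u) normal_sqnorm (2 * hessian_gradient u).
Proof.
rewrite normal_sqnormE -[2 * _]add0r; apply: is_deriveD.
rewrite mulr_sumr; apply: is_derive_fsum => k.
by rewrite mulrA mxE; apply: is_derive_sqr; exact: is_derive_DF.
Qed.

Variables (G : x_space R n -> tan_space R n) (W : set (x_space R n)).
Variable chi : x_space R n -> x_space R n.
Hypothesis G_chart : boundary_chart F G W chi.
Variable eta : tan_space R n.

(** For fixed [eta] and [tau], the numerator of [symbol_q] at [x] is the squared length of the
    gradient of [g] minus [tau ^+ 2]. *)
Let g x : R := dotr (G x) eta.

Let Wo : open W. Proof. exact: (chart_open G_chart). Qed.

Let g_smooth : smooth_on W g.
Proof.
exact: (smooth_on_comp_linear (finite_coordinates_row _) (linear_dotr eta) Wo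
  (chart_smooth G_chart)).
Qed.

Lemma derive_Gcomp v x j : W x -> 'D_v (Gcomp G j) x = 'D_v G x 0 j.
Proof.
move=> Wx; apply: (derive_comp_linear (finite_coordinates_row _) (linear_coord j)).
exact: smooth_on_derivable (chart_smooth G_chart) Wx.
Qed.

Let derive_g v x : W x -> 'D_v g x = \sum_j 'D_v (Gcomp G j) x * eta 0 j.
Proof.
move=> Wx; rewrite /g (derive_comp_linear (finite_coordinates_row _) (linear_dotr eta)).
  by apply: eq_bigr => j _; rewrite derive_Gcomp.
exact: smooth_on_derivable (chart_smooth G_chart) Wx.
Qed.

Let differentiable_g x : W x -> differentiable g x.
Proof. exact: (smooth_on_differentiable (finite_coordinates_x _) Wo g_smooth). Qed.

Let differentiable_Dg v x : W x -> differentiable (fun z => 'D_v g z) x.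
Proof.
exact: (smooth_on_differentiable (finite_coordinates_x _) Wo
  (smooth_on_derive v g_smooth)).
Qed.

Let differentiable_Gcomp j x : W x -> differentiable (Gcomp G j) x.
Proof.
apply: (smooth_on_differentiable (finite_coordinates_x _) Wo).
exact: (smooth_on_comp_linear (finite_coordinates_row _) (linear_coord j) Wo
  (chart_smooth G_chart)).
Qed.

Lemma derive_normal_Gcomp x j : W x -> 'D_(normal x) (Gcomp G j) x = 0.
Proof.
move=> Wx; rewrite (derive_gradx _ (differentiable_Gcomp j Wx)) mul1r.
exact: (chart_transport G_chart Wx).
Qed.

Lemma derive_normal_g x : W x -> 'D_(normal x) g x = 0.
Proof.
move=> Wx; rewrite derive_g//; apply: big1 => j _.
by rewrite derive_normal_Gcomp// mul0r.
Qed.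

Lemma gradx_g x : W x -> gradx g x = (dotr (dG1 G x) eta, eta *m dGT G x).
Proof.
move=> Wx; apply: injective_projections; rewrite /= ?derive_g//.
  by apply: eq_bigr => j _; rewrite mxE.
apply/rowP => k; rewrite !mxE derive_g//. apply: eq_bigr => j _.
by rewrite !mxE mulrC.
Qed.

(* The normal is frozen at [x]: by the transport equation its derivative of [g]
   at [z] only involves [gradT F x.2 - gradT F z.2]. *)
Lemma derive_frozen_normal x : W x -> let w := gradx g x in
  'D_w (fun z => 'D_(normal x) g z) x = - 'D_w.2 (fun u => 'D_w.2 F u) x.2.
Proof.
move=> Wx w; pose Fk k u := 'D_(delta_mx 0 k) F u.
pose gk k z := 'D_(0, delta_mx 0 k) g z.
have E : \forall z \near x,
    \sum_k (Fk k x.2 - Fk k z.2) * gk k z = 'D_(normal x) g z.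
  apply: filterS (near_open Wo Wx) => z Wz.
  transitivity ('D_(normal x) g z - 'D_(normal z) g z); last first.
    by rewrite (derive_normal_g Wz) subr0.
  rewrite !(derive_gradx _ (differentiable_g Wz)).
  rewrite /= opprD addrACA subrr add0r -sumrB; apply: eq_bigr => k _.
  by rewrite !mxE mulrBl.
rewrite -(near_eq_derive _ E) derive_DF_gradient -sumrN.
apply: derive_val; apply: is_derive_fsum => k.
have HF : is_derive x w (fun z => Fk k x.2 - Fk k z.2)
    (0 - 'D_w.2 (fun u => 'D_(delta_mx 0 k) F u) x.2).
  apply: is_deriveB; apply: is_derive_snd; exact: is_derive_DF.
have Hg : is_derive x w (gk k) ('D_w (gk k) x).
  exact/derivableP/diff_derivable/differentiable_Dg.
apply: is_derive_eq (is_derive_mul HF Hg) _.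
(* At [x] itself the factor [Fk k x.2 - Fk k z.2] is zero, so only the term differentiating that
   factor survives. *)
by rewrite subrr mul0r !add0r mulrN mxE.
Qed.

Let sqnormx_gradxE : (fun z => sqnormx (gradx g z)) =
  (fun z => ('D_(1, 0) g z) ^+ 2 + \sum_k ('D_(0, delta_mx 0 k) g z) ^+ 2).
Proof.
apply/funext => z; congr (_ + _); apply: eq_bigr => k _.
by rewrite !mxE expr2.
Qed.

(** With the normal [N] frozen, mixed derivatives commute, so the derivative of the squared gradient
    along [N] is twice the derivative of ['D_N g] along the gradient [w]; [derive_frozen_normal]
    evaluates it. *)
Lemma is_derive_normal_sqnorm_grad x : W x -> let w := gradx g x in
  is_derive x (normal x) (fun z => sqnormx (gradx g z))
    (- 2 * 'D_w.2 (fun u => 'D_w.2 F u) x.2).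
Proof.
move=> Wx w; set N := normal x.
rewrite sqnormx_gradxE.
have H v : is_derive x N (fun z => 'D_v g z) ('D_v (fun z => 'D_N g z) x).
  rewrite (derive_commute v N Wo g_smooth Wx).
  exact/derivableP/diff_derivable/differentiable_Dg.
apply: is_derive_eq (is_deriveD (is_derive_sqr (H (1, 0)))
  (is_derive_fsum (fun k => is_derive_sqr (H (0, delta_mx 0 k))))) _.
have E : 'D_w (fun z => 'D_N g z) x = - 'D_w.2 (fun u => 'D_w.2 F u) x.2.
  exact: derive_frozen_normal.
rewrite (derive_gradx _ (differentiable_Dg N Wx)) /= in E.
rewrite mulNr -mulrN -E mulrDr mulrA; congr (_ + _).
rewrite mulr_sumr; apply: eq_bigr => k _.
by rewrite !mxE mulrA.
Qed.

Let image_open : open (chart F G @` W).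
Proof. exact: (chart_image_open G_chart). Qed.

(** The transport equation kills the [y'] components. *)
Lemma is_derive_normal_chart x : W x ->
  is_derive x (normal x) (chart F G) (normal_sqnorm x.2, 0).
Proof.
move=> Wx; apply: is_derive_pair; last first.
  have dG := smooth_on_derivable (v := normal x) (chart_smooth G_chart) Wx.
  apply: is_derive_eq (derivableP dG) _; apply/rowP => j.
  by rewrite -derive_Gcomp// derive_normal_Gcomp// mxE.
apply: is_deriveD.
  exact: (is_derive_comp_linear (finite_coordinates_x _) (@linear_fst R _)
    (is_derive_id x _)).
apply: is_derive_snd; rewrite -derive_gradT; last exact: differentiable_F.
exact/derivableP/diff_derivable/differentiable_F.
Qed.

(** Differentiate the identity [chi (chart x) = x] along the normal. *)
Lemma derive_chart_inverse x : W x ->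
  normal_sqnorm x.2 *: 'D_(1, 0) chi (chart F G x) = normal x.
Proof.
move=> Wx; set a := normal_sqnorm x.2; set y := chart F G x.
have Wy : (chart F G @` W) y by exists x.
(* Testing against linear forms reduces to real-valued functions, to which
   [smooth_on_differentiable] applies. *)
suff H (L : x_space R n -> R^o) : linear L ->
    a * L ('D_(1, 0) chi y) = L (normal x).
  apply: injective_projections; first exact: (H _ (@linear_fst R _)).
  by apply/rowP => j; rewrite mxE; exact: (H _ (@linear_snd_coord R _ j)).
move=> lL.
have sL := smooth_on_comp_linear (finite_coordinates_x _) lL image_open
  (chart_inv_smooth G_chart).
have dL := smooth_on_differentiable (finite_coordinates_x _) image_open sL Wy.
have -> : a * L ('D_(1, 0) chi y) = 'D_(a, 0) (fun z => L (chi z) : R) y.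
  rewrite -(derive_comp_linear (finite_coordinates_x _) lL); last first.
    exact: smooth_on_derivable (chart_inv_smooth G_chart) Wy.
  rewrite !deriveE// (_ : (a, 0) = a *: (1, 0)) ?linearZ//.
  by apply: injective_projections => /=; rewrite ?scaler0// [RHS]mulr1.
have E : x = x + 0 *: normal x by rewrite scale0r addr0.
have Hc : is_derive (0 : R) 1 (fun h => chart F G (x + h *: normal x)) (a, 0).
  apply: (is_derive_line (chart F G) x (normal x) 0 (a, 0)).1.
  by rewrite -E; exact: is_derive_normal_chart.
have Hid : is_derive (0 : R) 1 (fun h => L (x + h *: normal x) : R) (L (normal x)).
  apply: (is_derive_comp_linear (finite_coordinates_x _) lL).
  by apply: (is_derive_line id x (normal x) 0 (normal x)).1; exact: is_derive_id.
rewrite -(@derive_val _ _ _ _ _ _ _ Hid).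
have dL' : differentiable (fun z => L (chi z) : R) (chart F G (x + 0 *: normal x)).
  by rewrite -E.
have := is_derive_comp_curve dL' Hc; rewrite -E => -[_ <-].
apply: near_eq_derive.
have : (fun h : R => x + h *: normal x) @ (0 : R) --> x.
  rewrite [X in _ --> X]E; apply: cvgD; first exact: cvg_cst.
  by apply: cvgZr_tmp; exact: cvg_id.
move=> Hcv; have nW : \forall h \near (0 : R), W (x + h *: normal x).
  exact: (Hcv _ (near_open Wo Wx)).
by apply: filterS nW => h Wh; rewrite /= (chart_invK G_chart).
Qed.

(** By the chart, [d_{y_1}] is the normal derivative divided by [normal_sqnorm]; the quotient rule
    then applies. [H] is the Hessian form of [F] on the tangential part of the gradient of [g], and
    only its sign matters later. *)
Lemma is_derive_symbol_q x tau : convex_function setT F -> W x ->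
  exists2 H, 0 <= H &
  is_derive (chart F G x) (1, 0) (fun y => symbol_q F G chi y tau eta)
   (- (2 * H + 2 * symbol_q F G chi (chart F G x) tau eta * hessian_gradient x.2)
      / normal_sqnorm x.2 ^+ 2).
Proof.
move=> F_convex Wx; set a := normal_sqnorm x.2; set y := chart F G x.
set q := symbol_q _ _ _ _ _ _; set B := hessian_gradient _.
pose w := gradx g x; exists ('D_w.2 (fun u => 'D_w.2 F u) x.2).
  exact: convex_derive2_ge0.
(* The symbol read in the variables [x]. *)
pose Q z := (sqnormx (gradx g z) - tau ^+ 2) / normal_sqnorm z.2.
have symbolE z : (chart F G @` W) z -> symbol_q F G chi z tau eta = Q (chi z).
  move=> [u Wu <-]; rewrite /symbol_q (chart_invK G_chart)// /Q gradx_g//.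
have Wy : (chart F G @` W) y by exists x.
have chiy : chi y = x by rewrite (chart_invK G_chart).
have a0 : a != 0 by rewrite gt_eqF// normal_sqnorm_gt0.
have dS : differentiable (fun z => sqnormx (gradx g z)) x.
  rewrite sqnormx_gradxE; apply: differentiableD.
    exact/differentiable_sqr/differentiable_Dg.
  by apply: differentiable_fsum => k; exact/differentiable_sqr/differentiable_Dg.
have dQ : differentiable Q x.
  apply: differentiableM; first exact: differentiableB.
  apply: differentiableV => //.
  apply: differentiable_snd_comp; rewrite normal_sqnormE.
  apply: differentiableD => //; apply: differentiable_fsum => k.
  exact/differentiable_sqr/differentiable_DF.
have DQ : is_derive x (normal x) Q
   ((- 2 * 'D_w.2 (fun u => 'D_w.2 F u) x.2 * a
     - (sqnormx w - tau ^+ 2) * (2 * B)) / a ^+ 2).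
  apply: is_derive_quot.
  - exact: a0.
  - apply: is_derive_eq (is_deriveB (is_derive_normal_sqnorm_grad Wx)
      (is_derive_cst (tau ^+ 2) _ _)) _.
    by rewrite subr0.
  - by apply: is_derive_snd; exact: is_derive_normal_sqnorm.
(* The chain rule is used for [Q] along the curve [h |-> chi (y + h *: (1, 0))], so only a
   directional derivative of [chi] enters. *)
have Hchi : is_derive (0 : R) 1 (fun h => chi (y + h *: (1, 0))) ('D_(1, 0) chi y).
  apply: (is_derive_line chi y (1, 0) 0 _).1.
  rewrite scale0r addr0; apply: derivableP.
  exact: smooth_on_derivable (chart_inv_smooth G_chart) Wy.
have E : y + 0 *: (1, 0) = y by rewrite scale0r addr0.
have dQ' : differentiable Q (chi (y + 0 *: (1, 0))) by rewrite E chiy.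
have := is_derive_comp_curve dQ' Hchi; rewrite E chiy => HQ.
have X_E : 'D_(1, 0) chi y = a^-1 *: normal x.
  by rewrite -derive_chart_inverse// scalerA mulVf// scale1r.
have dE : 'D_('D_(1, 0) chi y) Q x =
    - (2 * 'D_w.2 (fun u => 'D_w.2 F u) x.2 + 2 * q * B) / a ^+ 2.
  rewrite X_E deriveE// linearZ /= -deriveE// (@derive_val _ _ _ _ _ _ _ DQ).
  have -> : q = (sqnormx w - tau ^+ 2) / a by rewrite /q symbolE// chiy.
  by rewrite -[_ *: _]/(_ * _); field.
rewrite dE in HQ; rewrite -[y in is_derive y]E.
apply: (is_derive_line (fun z => symbol_q F G chi z tau eta) y (1, 0) 0 _).2.
apply: near_eq_is_derive HQ.
have Hcv : (fun h : R => y + h *: ((1, 0) : x_space R n)) @ (0 : R) --> y.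
  rewrite -[X in _ --> X]E; apply: cvgD; first exact: cvg_cst.
  by apply: cvgZr_tmp; exact: cvg_id.
have nWy : \forall h \near (0 : R), (chart F G @` W) (y + h *: (1, 0)).
  exact: (Hcv _ (near_open image_open Wy)).
by apply: filterS nWy => h Wh; rewrite symbolE.
Qed.

End boundary.

(** * Positivity of the normal covector component *)

Section real_functions.
Context {R : realType}.

(** With [M] bounding [C * f], the product of [f] and [expR (M * u)] does not decrease before the
    first zero of [f], so that zero cannot occur. *)
Lemma positive_of_quadratic_decay (f C : R -> R) (s : R) : 0 <= s -> 0 < f 0 ->
  (forall u, 0 <= u <= s -> {for u, continuous C}) ->
  (forall u, 0 <= u <= s -> derivable f u 1) ->
  (forall u, 0 < u < s -> - (C u * f u ^+ 2) <= 'D_1 f u) -> 0 < f s.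
Proof.
move=> s0 f0 cC df Hf.
have cf u : 0 <= u <= s -> {for u, continuous f}.
  by move=> us; apply/differentiable_continuous/derivable1_diffP/df.
have [M M0 HM] : exists2 M, 0 <= M & forall u, 0 <= u <= s -> C u * f u <= M.
  have [|c cs cM] := @EVT_max R (fun u => `|C u * f u|) 0 s s0.
    apply: continuous_in_subspaceT => u; rewrite inE /= in_itv /= => us.
    by apply: cvg_norm; apply: cvgM; [exact: cC|exact: cf].
  exists (`|C c * f c|) => // u us; apply: le_trans (ler_norm _) (cM _ _).
  by rewrite in_itv.
rewrite ltNge; apply/negP => fs.
pose A := [set u | 0 <= u <= s /\ f u <= 0].
have A0 : A !=set0 by exists s; rewrite /A /= s0 lexx.
have lA : has_lbound A by exists 0 => u -[/andP[]].
(* The first point where [f] fails to be positive; continuity shows that it belongs to [A]. *)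
pose t := inf A.
have ts : 0 <= t <= s.
  apply/andP; split; first by apply: lb_le_inf => // u -[/andP[]].
  by apply: ge_inf => //; rewrite /A /= s0 lexx.
have ft : f t <= 0.
  rewrite leNgt; apply/negP => ft.
  have [d d0 dP] := (nbhs_ballP _ _).1 (cf t ts _ (lt_nbhsr ft)).
  have [u [us fu] ut] := inf_adherent d0 (conj A0 lA).
  have tu : t <= u by exact: ge_inf.
  have : 0 < f u.
    apply: dP; rewrite -ball_normE /= distrC ger0_norm ?subr_ge0//.
    by rewrite ltrBlDl.
  by rewrite ltNge fu.
have tpos : 0 < t.
  case/andP: ts => t0 _; rewrite lt_neqAle t0 andbT; apply/eqP => t0'.
  by move: ft; rewrite -t0' leNgt f0.
have fpos u : 0 <= u < t -> 0 < f u.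
  move=> /andP[u0 ut]; rewrite ltNge; apply/negP => fu.
  have : t <= u.
    apply: ge_inf => //; split => //; rewrite u0 (le_trans (ltW ut))//.
    by case/andP: ts.
  by rewrite leNgt ut.
pose g u := f u * expR (M * u).
have dg u : 0 <= u <= s ->
    is_derive u (1 : R) g (f u * (M * expR (M * u)) + expR (M * u) * 'D_1 f u).
  move=> us; apply: is_derive_mul; first exact/derivableP/df.
  have dM : is_derive u (1 : R) (fun u => M * u) M.
    apply: is_derive_eq (is_derive_mul (is_derive_cst M u 1) (is_derive_id u 1)) _.
    by rewrite mulr1 mulr0 addr0.
  apply: is_derive_eq (is_derive1_comp (is_derive_expR (M * u)) dM) _.
  exact: mulrC.
have [||c ct E] := @MVT R g
  (fun u => f u * (M * expR (M * u)) + expR (M * u) * 'D_1 f u) 0 t tpos.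
- move=> u; rewrite in_itv /= => /andP[u0 ut]; apply: dg.
  by rewrite ltW//= (le_trans (ltW ut))//; case/andP: ts.
- apply: derivable_within_continuous => u; rewrite in_itv /= => /andP[u0 ut].
  by have [] := dg u _; rewrite // u0 (le_trans ut)//; case/andP: ts.
move: ct; rewrite in_itv /= => /andP[c0 ct].
have cs : c < s by apply: lt_le_trans ct _; case/andP: ts.
have fc : 0 < f c by apply: fpos; rewrite ltW.
have : 0 <= g t - g 0.
  rewrite E mulr_ge0 ?subr0 ?(ltW tpos)//.
  (* Regrouped so that the first summand is nonnegative by the choice of [M] and the second by the
     differential inequality. *)
  have -> : f c * (M * expR (M * c)) + expR (M * c) * 'D_1 f c =
    expR (M * c) * (f c * (M - C c * f c) + ('D_1 f c + C c * f c ^+ 2)) by ring.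
  rewrite mulr_ge0 ?expR_ge0// addr_ge0//.
    by rewrite mulr_ge0 ?(ltW fc)// subr_ge0 HM// ltW//= ltW.
  by rewrite -[X in _ + X]opprK subr_ge0 Hf// c0.
rewrite subr_ge0 /g mulr0 expR0 mulr1 leNgt => /negP; apply.
by rewrite (le_lt_trans _ f0)// mulr_le0_ge0// expR_ge0.
Qed.

Lemma derive_at_left_zero_le0 (f : R -> R) (s d : R) : 0 < s ->
  is_derive s (1 : R) f d -> (forall u, 0 <= u <= s -> 0 <= f u) -> f s = 0 ->
  d <= 0.
Proof.
move=> s0 /is_derive_cvg H f0 fs; rewrite leNgt; apply/negP => d0.
have := H _ (lt_nbhsr d0) => /nbhs_ballP[e e0 /= eP].
(* A step to the left, short enough for the limit estimate and for [s + h] to remain nonnegative. *)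
pose h := - Num.min (e / 2) s.
have m0 : 0 < Num.min (e / 2) s by rewrite lt_min divr_gt0.
have h0 : h < 0 by rewrite oppr_lt0.
have : 0 < h^-1 * f (h + s).
  have -> : h + s = h *: 1 + s by rewrite -[h *: 1]/(h * 1) mulr1.
  have := eP h; rewrite /= fs subr0; apply; last by rewrite lt_eqF.
  rewrite -ball_normE /= sub0r normrN ltr0_norm// opprK gt_min.
  by rewrite ltr_pdivrMr// ltr_pMr// ltr1n.
rewrite nmulr_rgt0 ?invr_lt0// ltNge f0//.
by rewrite addrC subr_ge0 ge_min lexx orbT gerDl ltW.
Qed.

End real_functions.

(** * The Hamiltonian field of a quadratic symbol *)

Section hamiltonian.
Context {R : realType} {n : nat}.
Implicit Types (z zeta v : tx_space R n).

Definition dottx (v zeta : tx_space R n) : R :=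
  v.1 * zeta.1 + (v.2.1 * zeta.2.1 + dotr v.2.2 zeta.2.2).

Lemma dottxC v zeta : dottx v zeta = dottx zeta v.
Proof.
by rewrite /dottx dotrC; congr (_ + (_ + _)); exact: mulrC.
Qed.

Lemma derive_gradtx (f : tx_space R n -> R) z v :
  differentiable f z -> 'D_v f z = dottx v (gradtx f z).
Proof.
move=> df; have vE : v = v.1 *: (1, 0) + (v.2.1 *: (0, (1, 0)) +
    \sum_j v.2.2 0 j *: (0, (0, delta_mx 0 j))).
  apply: injective_projections => /=; last apply: injective_projections => /=.
  - rewrite raddf_sum big1/= => [|i _]; last by rewrite [LHS]mulr0.
    by rewrite [_ *: 0]mulr0 !addr0 [RHS]mulr1.
  - rewrite !raddf_sum big1/= => [|i _]; last by rewrite [LHS]mulr0.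
    by rewrite [_ *: 0]mulr0 add0r addr0 [RHS]mulr1.
  - by rewrite !raddf_sum/= !scaler0 !add0r {1}[v.2.2]row_sum_delta.
rewrite {1}vE deriveE// !linearD !linearZ linear_sum /=; congr (_ * _ + (_ * _ + _)).
- by rewrite /= deriveE.
- by rewrite /= deriveE.
by apply: eq_bigr => j _; rewrite linearZ /= mxE deriveE.
Qed.

Lemma linear_eta1 : linear ((fun zeta => zeta.2.1) : tx_space R n -> R^o).
Proof. by []. Qed.

Variables (F : tan_space R n -> R) (G : x_space R n -> tan_space R n).
Variable chi : x_space R n -> x_space R n.
Let p := symbol_p F G chi.

Lemma symbol_pZ z zeta (c : R) : p z (c *: zeta) = c ^+ 2 * p z zeta.
Proof.
rewrite /p /symbol_p /symbol_q /= -scalemxAl.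
set x := chi z.2; set v := _ *m _.
have -> : dotr (dG1 G x) (c *: zeta.2.2) = c * dotr (dG1 G x) zeta.2.2.
  by rewrite /dotr mulr_sumr; apply: eq_bigr => j _; rewrite !mxE; ring.
have -> : dotr (c *: v) (c *: v) = c ^+ 2 * dotr v v.
  by rewrite /dotr mulr_sumr; apply: eq_bigr => j _; rewrite !mxE; ring.
by rewrite -[c *: zeta.2.1]/(c * zeta.2.1) -[c *: zeta.1]/(c * zeta.1); ring.
Qed.

Let differentiable_linear (L : tx_space R n -> R^o) zeta :
  linear L -> differentiable (L : tx_space R n -> R) zeta.
Proof.
move=> lL.
pose LM := GRing.isLinear.Build _ _ _ _ _ lL.
pose LL : {linear (tx_space R n) -> R^o} := HB.pack L LM.
apply: (@linear_differentiable _ _ _ LL).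
exact: (finite_coordinates_linear_continuous (finite_coordinates_tx n) lL).
Qed.

Lemma differentiable_symbol_p z zeta : differentiable (p z) zeta.
Proof.
have lin_eta u : linear ((fun zeta => dotr u zeta.2.2) : tx_space R n -> R^o).
  by move=> a w w' /=; rewrite /dotr scaler_sumr -big_split /=;
    apply: eq_bigr => j _; rewrite !mxE mulrDr -[_ *: _]/(_ * _); ring.
apply: differentiableD; first exact/differentiable_sqr/differentiable_linear.
rewrite /symbol_q; apply: differentiableM; last exact: differentiable_cst.
apply: differentiableB; last exact/differentiable_sqr/differentiable_linear.
apply: differentiableD; first exact/differentiable_sqr/differentiable_linear.
apply: differentiable_fsum => k; under eq_fun do rewrite -expr2.
apply/differentiable_sqr/differentiable_linear => a w w'.
by rewrite /= mulmxDl -scalemxAl !mxE.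
Qed.

(** Homogeneity makes [p z] along the ray through [zeta] equal to [(1 + h) ^+ 2 * p z zeta],
    differentiated at [h = 0]. *)
Lemma euler_symbol_p z zeta : dottx zeta (gradtx (p z) zeta) = 2 * p z zeta.
Proof.
rewrite -(derive_gradtx _ (differentiable_symbol_p z zeta)).
apply: derive_val.
have E : zeta = zeta + 0 *: zeta by rewrite scale0r addr0.
rewrite [X in is_derive X]E; apply/is_derive_line.
have -> : (fun h : R => p z (zeta + h *: zeta)) =
    (fun h => (1 + h) ^+ 2 * p z zeta).
  by apply/funext => h; rewrite -{1}[zeta]scale1r -scalerDl symbol_pZ.
have H1 : is_derive (0 : R) 1 (fun h : R => 1 + h) (0 + 1).
  exact: (is_deriveD (is_derive_cst _ _ _) (is_derive_id _ _)).
apply: is_derive_eq (is_derive_mul (is_derive_sqr H1) (is_derive_cst _ _ _)) _.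
by rewrite addr0 add0r mulr0 add0r !mulr1 mulrC.
Qed.

Lemma gradtx_symbol_p_eta1 z zeta : (gradtx (p z) zeta).2.1 = 2 * zeta.2.1.
Proof.
rewrite /=; apply: derive_val.
have E : zeta = zeta + 0 *: (0, (1, 0)) by rewrite scale0r addr0.
rewrite [X in is_derive X]E; apply/is_derive_line.
have -> : (fun h : R => p z (zeta + h *: (0, (1, 0)))) =
    (fun h => (zeta.2.1 + h) ^+ 2 + symbol_q F G chi z.2 zeta.1 zeta.2.2).
  apply/funext => h; rewrite (_ : _ + _ = (zeta.1, (zeta.2.1 + h, zeta.2.2)))//.
  apply: injective_projections => /=; last apply: injective_projections => /=.
  - by rewrite [_ *: 0]mulr0 addr0.
  - by rewrite [_ *: 1]mulr1.
  - by rewrite scaler0 addr0.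
have H1 : is_derive (0 : R) 1 (fun h : R => zeta.2.1 + h) (0 + 1).
  exact: (is_deriveD (is_derive_cst _ _ _) (is_derive_id _ _)).
apply: is_derive_eq (is_deriveD (is_derive_sqr H1) (is_derive_cst _ _ _)) _.
by rewrite /=; ring.
Qed.

End hamiltonian.

(** * Evolution of the normal covector along rays *)

Section reflected_ray.
Context {R : realType} {n : nat} (F : tan_space R n -> R).
Hypothesis F_smooth : smooth_on setT F.
Hypothesis F_convex : convex_function setT F.
Variables (G : x_space R n -> tan_space R n) (W : set (x_space R n)).
Variable chi : x_space R n -> x_space R n.
Hypothesis G_chart : boundary_chart F G W chi.
Let Y := chart F G @` W.
Let p := symbol_p F G chi.

(** The coefficient left in [- d_{y_1} q] once [q] is replaced by minus the square of [eta_1] and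
    the nonnegative convexity term is dropped. *)
Let curvature (u : tan_space R n) : R :=
  2 * hessian_gradient F u / normal_sqnorm F u ^+ 2.

Let continuous_curvature : continuous curvature.
Proof.
move=> u; apply: differentiable_continuous.
have dN : differentiable (normal_sqnorm F) u.
  rewrite normal_sqnormE; apply: differentiableD => //.
  by apply: differentiable_fsum => k; exact/differentiable_sqr/differentiable_DF.
apply: differentiableM; last first.
  apply: differentiableV; first exact: (differentiable_sqr dN).
  by rewrite expf_neq0// gt_eqF// normal_sqnorm_gt0.
apply: differentiableM; first exact: differentiable_cst.
(* The direction [gradT F u] varies with [u]; expanding it leaves second derivatives in fixed
   directions, which are smooth. *)
have -> : hessian_gradient F = (fun u => \sum_k 'D_(delta_mx 0 k) F u *
   \sum_j 'D_(delta_mx 0 j) F u *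
      'D_(delta_mx 0 j) (fun w => 'D_(delta_mx 0 k) F w) u).
  apply/funext => w; apply: eq_bigr => k _; rewrite mxE; congr (_ * _).
  rewrite (derive_gradT _ (differentiable_DF F_smooth _ _)).
  by apply: eq_bigr => j _; rewrite !mxE.
apply: differentiable_fsum => k.
apply: differentiableM; first exact: differentiable_DF.
apply: differentiable_fsum => j.
apply: differentiableM; first exact: differentiable_DF.
exact: (differentiable_DF (smooth_on_derive _ F_smooth)).
Qed.

Lemma hamilton_eta1 (z zeta : R -> tx_space R n) (s : R) :
  hamilton_at Y p z zeta s -> p (z s) (zeta s) = 0 ->
  - (curvature (chi (z s).2).2 * (zeta s).2.1 ^+ 2)
    <= 'D_1 (fun u => (zeta u).2.1) s.
Proof.
move=> [[x Wx zx] _ Hzeta] p0.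
have [H H0 HQ] :=
  is_derive_symbol_q F_smooth G_chart (zeta s).2.2 (zeta s).1 F_convex Wx.
rewrite zx in HQ.
have Hp := is_deriveD (is_derive_cst ((zeta s).2.1 ^+ 2) (z s) (0, (1, 0)))
  (@is_derive_snd _ _ _ _ (z s) (0, (1, 0)) _ HQ).
have := is_derive_comp_linear (finite_coordinates_tx n) (@linear_eta1 R n) Hzeta.
move=> /(@derive_val _ _ _ _ _ _ _) ->.
have := @derive_val _ _ _ _ _ _ _ Hp => HpE.
rewrite [leRHS](congr1 -%R HpE) add0r -zx (chart_invK G_chart)// zx.
have -> : symbol_q F G chi (z s).2 (zeta s).1 (zeta s).2.2 = - (zeta s).2.1 ^+ 2.
  by apply/eqP; rewrite -addr_eq0 addrC -[X in X == _]/(p (z s) (zeta s)) p0.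
have a0 : 0 < normal_sqnorm F x.2 ^+ 2 by rewrite exprn_gt0// normal_sqnorm_gt0.
rewrite /curvature -subr_ge0.
(* The gap between the two sides is exactly the convexity term. *)
rewrite (_ : _ - _ = 2 * H / normal_sqnorm F x.2 ^+ 2).
  by rewrite divr_ge0 ?(ltW a0)// mulr_ge0.
by field; rewrite gt_eqF// normal_sqnorm_gt0.
Qed.

(** Vanishing of [p] is asked only at interior parameters: it will come from constancy of the phase
    on a two-sided neighbourhood of the parameter. *)
Lemma eta1_stays_positive (z zeta : R -> tx_space R n) (s : R) : 0 <= s ->
  (forall u, 0 <= u <= s -> hamilton_at Y p z zeta u) ->
  (forall u, 0 < u < s -> p (z u) (zeta u) = 0) ->
  0 < (zeta 0).2.1 -> 0 < (zeta s).2.1.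
Proof.
move=> s0 Hz p0 eta0.
apply: (@positive_of_quadratic_decay R (fun u => (zeta u).2.1)
  (fun u => curvature (chi (z u).2).2)) => // u us.
- have [Yz [dz _] _] := Hz u us.
  have cz : {for u, continuous z} by exact/differentiable_continuous/derivable1_diffP.
  have cchi := smooth_on_continuous (chart_inv_smooth G_chart) Yz.
  apply: (@continuous_comp _ _ _ (fun u => (chi (z u).2).2) curvature).
    apply: (@continuous_comp _ _ _ (fun u => chi (z u).2) snd); last exact: cvg_snd.
    apply: (@continuous_comp _ _ _ (fun u => (z u).2) chi); last exact: cchi.
    by apply: (@continuous_comp _ _ _ z snd); [exact: cz|exact: cvg_snd].
  exact: continuous_curvature.
- have [_ _ Hzeta] := Hz u us.
  by have [] := is_derive_comp_linear (finite_coordinates_tx n) (@linear_eta1 R n) Hzeta.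
- apply: hamilton_eta1; last exact: p0.
  by apply: Hz; case/andP: us => u0 u1; rewrite !ltW.
Qed.

Variables (rho : R) (phi : tx_space R n -> R).

(** Along the incoming ray [y_1] is nonnegative and reaches 0 at the end, so its final derivative,
    twice [d_{y_1} phi], is at most 0; equality would mean grazing. *)
Lemma incoming_at_boundary (T : R) (S : set (tx_space R n)) w :
  (forall z, S z -> 0 < z.2.1) -> reflect_set0 p rho phi T S w ->
  (gradtx phi (boundary_pt w)).2.1 < 0.
Proof.
move=> S0 [[gamma [s [s0 Sg gs Hg]]] nG].
(* The source lies in [y_1 > 0], so a ray ending on the boundary takes positive time and a left
   derivative is available. *)
have sN0 : s != 0.
  apply/eqP => E; have : 0 < (boundary_pt w).2.1 by rewrite -gs E; exact: S0.
  by rewrite ltxx.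
have sp : 0 < s by rewrite lt_neqAle eq_sym sN0.
have [ball_s _ _ Hs] := Hg s ltac:(by rewrite s0 lexx).
have He := is_derive_comp_linear (finite_coordinates_tx n) (@linear_eta1 R n) Hs.
rewrite gs /ray_field gradtx_symbol_p_eta1 in He.
rewrite lt_neqAle; apply/andP; split.
  by apply/eqP => E; apply: nG; split; rewrite // -gs.
rewrite -(pmulr_rle0 _ (ltr0n _ 2)); apply: derive_at_left_zero_le0 sp He _ _.
  by move=> u us; have [] := Hg u us.
by rewrite gs.
Qed.

(** The derivative of the phase along the ray is the pairing of its gradient [zeta] with the
    covector gradient of [p], which Euler's identity equates with [2 * p]; constancy makes it
    zero. *)
Lemma reflected_symbol_vanishes (z zeta : R -> tx_space R n) (D : set (tx_space R n))
    (phi_r : tx_space R n -> R) (u c : R) :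
  open D -> smooth_on D phi_r -> D (z u) ->
  hamilton_at Y p z zeta u -> gradtx phi_r (z u) = zeta u ->
  (\forall v \near u, phi_r (z v) = c) -> p (z u) (zeta u) = 0.
Proof.
move=> oD sphi Dz [_ Hz _] gphi nc.
have dphi := smooth_on_differentiable (finite_coordinates_tx n) oD sphi Dz.
have H1 := is_derive_comp_curve dphi Hz.
have nc' : \forall v \near u, cst c v = (phi_r \o z) v.
  by apply: filterS nc => v E; rewrite /= E.
have H2 := near_eq_is_derive nc' (is_derive_cst c u (1 : R)).
have : 'D_(gradtx (p (z u)) (zeta u)) phi_r (z u) = 0.
  by rewrite -(@derive_val _ _ _ _ _ _ _ H1) (@derive_val _ _ _ _ _ _ _ H2).
rewrite (derive_gradtx _ dphi) gphi dottxC.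
by rewrite euler_symbol_p => /eqP; rewrite mulf_eq0 pnatr_eq0 => /eqP.
Qed.

End reflected_ray.

Theorem mainTheorem11 (R : realType) (n : nat) (hn : (2 <= n)%N)
    (F : tan_space R n -> R)
    (F_smooth : smooth_on setT F)
    (F_convex : convex_function setT F)
    (origin_boundary :
       (closure (obstacle F) `\` interior (obstacle F)) (0 : x_space R n))
    (G : x_space R n -> tan_space R n) (W : set (x_space R n))
    (chi : x_space R n -> x_space R n)
    (G_chart : boundary_chart F G W chi)
    (Y := chart F G @` W) (p := symbol_p F G chi)
    (rho : R) (phi_i : tx_space R n -> R)
    (phi_i_incoming : incoming_phase Y p rho phi_i)
    (T : R) (T_gt0 : 0 < T)
    (c : x_space R n) (r : R) (S := source T c r)
    (S_admissible : admissible_source rho T c r)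
    (s0 : R) (s0_gt0 : 0 < s0)
    (Z Theta : R * (R * tan_space R n) -> tx_space R n)
    (Z_flow : reflected_flow Y p rho phi_i T s0 S Z Theta)
    (phi_r : tx_space R n -> R)
    (phi_r_reflected : reflected_phase p rho phi_i T s0 S Z Theta phi_r) :
  (forall z, reflected_range0 p rho phi_i T s0 S Z z ->
     0 < 'D_((0, (1, 0)) : tx_space R n) phi_r z) /\
  (forall z, reflected_range0 p rho phi_i T s0 S Z z ->
     'D_((0, (1, 0)) : tx_space R n) phi_r z != 0).

Proof.
suff pos z : reflected_range0 p rho phi_i T s0 S Z z ->
    0 < 'D_((0, (1, 0)) : tx_space R n) phi_r z.
  by split=> // z /pos pz; rewrite gt_eqF.
move=> [[s w] dom <-].
have [[D [oD rangeD sphi]] phiE gradE] := phi_r_reflected.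
have [_ init_cov Hflow _ _] := Z_flow.
have [/= Bw /andP[ss0 ss] TZ] := dom.
(* The flow domain contains every initial piece of a ray it contains. *)
have domain u : 0 <= u <= s -> flow_domain T s0 Z (reflect_set0 p rho phi_i T S) (u, w).
  move=> /andP[u0 us]; split => //=; first by rewrite u0 (le_lt_trans us).
  by move=> v /andP[v0 vu]; apply: TZ; rewrite v0 (le_trans vu).
have -> : 'D_((0, (1, 0)) : tx_space R n) phi_r (Z (s, w)) = (Theta (s, w)).2.1.
  by rewrite -gradE.
have Hz u : 0 <= u <= s -> hamilton_at Y p (fun s => Z (s, w)) (fun s => Theta (s, w)) u.
  move=> /domain[[rw _] us TZu].
  by apply: (Hflow (u, w)).
apply: (eta1_stays_positive F_smooth F_convex G_chart
  (z := fun s => Z (s, w)) (zeta := fun s => Theta (s, w)) ss0 Hz).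
- move=> u /andP[u0 us].
  have uI : 0 <= u <= s by rewrite !ltW.
  apply: (reflected_symbol_vanishes (c := phi_i (boundary_pt w)) oD sphi _ (Hz u uI)).
  + by apply: rangeD; exists (u, w) => //; exact: domain.
  + exact: gradE (domain u uI).
  (* On the open interval [phi_r] keeps the boundary value of [phi_i] at the foot [w] of the ray. *)
  + have nI : \forall v \near u, v \in `]0, s[%R.
      by apply: near_in_itvoo; rewrite in_itv /= u0.
    apply: filterS nI => v; rewrite in_itv /= => /andP[v0 vs].
    by apply: phiE (domain v _); rewrite !ltW.
- have [Rw _] := Bw.
  (* Reflection flips the sign of the normal component, so its initial positivity is the strict
     negativity of the incoming one. *)
  rewrite init_cov// /reflected_covector /= oppr_gt0.
  apply: (incoming_at_boundary _ Bw) => z' Sz.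
  by have [_ /(_ z' Sz)[]] := S_admissible.
Qed.
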